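(* For an $M\times K$ F-RAN with each edge node having fractional cache size $\mu\in[0,1]$ and fronthaul rate $r\ge0$, the minimum NDT (serial fronthaul-edge transmission) satisfies $$\delta^*(\mu,r)\ \le\ \delta_{\mathsf{Cl-Sf}}:=\frac{K}{\min\{M,K\}}+\frac{K}{Mr}.$$
   Context: F-RAN model (serial transmission). $M$ edge nodes (ENs) serve $K$ users from a library of $N\ge K$ files $F_1,\dots,F_N$, independent and uniform on $\{1,\dots,2^L\}$. The channel $\mathbf H=(h_{km})\in\mathbb C^{K\times M}$ has entries drawn i.i.d. from a continuous distribution, is constant during a transmission interval and known to all nodes. The demand vector $\mathbf D=(d_1,\dots,d_K)\in\{1,\dots,N\}^K$ is known to the cloud and ENs. With power $P$ and fronthaul rate $r\ge0$, put $C_F=r\log P$. A policy for file size $L$ consists of: (a) caching functions $S_{m,n}=\pi^m_{c,n}(F_n)$ with entropy $H(S_{m,n})\le\mu L$ (not depending on $\mathbf D,\mathbf H$), with $S_m=(S_{m,1},\dots,S_{m,N})$; (b) fronthaul messages $\mathbf U_m^{T_F}=\pi_f^m(F_1,\dots,F_N,S_m,\mathbf D,\mathbf H)$ of at most $T_FC_F$ bits; (c) edge codewords $\mathbf X_m^{T_E}=\pi_e^m(S_m,\mathbf U_m^{T_F},\mathbf D,\mathbf H)\in\mathbb C^{T_E}$ with average power at most $P$; (d) decoders $\widehat F_{d_k}=\pi_d^k(\mathbf Y_k^{T_E},d_k,\mathbf H)$, where $\mathbf Y_k^{T_E}=\sum_{m=1}^M h_{km}\mathbf X_m^{T_E}+\mathbf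 n_k^{T_E}$ and the noise entries are i.i.d. $\mathcal{CN}(0,1)$ over time and users. The error probability is $P_e=\max_{\mathbf D}\max_k\mathbb P(\widehat F_{d_k}\ne F_{d_k})$. A sequence of policies indexed by $L$ is feasible if, for almost all $\mathbf H$, $P_e\to0$ as $L\to\infty$. A delivery time per bit $\Delta(\mu,C_F,P)$ is achievable if some sequence of feasible policies has $\Delta(\mu,C_F,P)=\limsup_{L\to\infty}(T_F+T_E)/L$. The corresponding (achievable) normalized delivery time is $\delta(\mu,r)=\lim_{P\to\infty}\Delta(\mu,r\log P,P)\,\log P$. The minimum NDT $\delta^*(\mu,r)$ is the infimum of all achievable $\delta(\mu,r)$ ($+\infty$ if there is none). Convention: $K/(Mr)=+\infty$ for $r=0$.
   Formalization: The durations T_F, T_E, and hence Δ, may depend on the channel H (known to all nodes), and an achievable NDT is a constant equal to lim Δ·log P for almost all H; with durations common to all H the bound fails, e.g. for M=K=1 with Rayleigh fading. *)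

(* Defs.v *)
From HB Require Import structures.
From mathcomp Require Import all_boot all_order all_algebra.
From mathcomp Require Import all_classical all_reals all_analysis.
From mathcomp Require Import complex.

Set Implicit Arguments.
Unset Strict Implicit.
Unset Printing Implicit Defensive.

Import Order.TTheory GRing.Theory Num.Theory.
Import numFieldNormedType.Exports.

Local Open Scope classical_set_scope.
Local Open Scope complex_scope.
Local Open Scope ring_scope.

Definition log2 {R : realType} (x : R) : R := ln x / ln 2.

(* R[i] carries the Borel sigma-algebra of R * R. *)
Section complex_measurable.
Context {R : realType}.

Definition complex_of_pair (p : measurableTypeR R * measurableTypeR R) :
  R[i] := p.1 +i* p.2.

HB.instance Definition _ := isPointed.Build R[i] (0 +i* 0).

Definition complex_measurable : set (set R[i]) :=
  [set A | measurable (complex_of_pair @^-1` A)].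

Let complex_measurable0 : complex_measurable set0.
Proof. by rewrite /complex_measurable /= preimage_set0; exact: measurable0. Qed.

Let complex_measurableC A :
  complex_measurable A -> complex_measurable (~` A).
Proof.
by move=> mA; rewrite /complex_measurable /= preimage_setC; exact: measurableC.
Qed.

Let complex_measurable_bigcup (F : (set R[i])^nat) :
  (forall i, complex_measurable (F i)) ->
  complex_measurable (\bigcup_i F i).
Proof.
by move=> mF; rewrite /complex_measurable /= preimage_bigcup;
  exact: bigcupT_measurable.
Qed.

HB.instance Definition _ :=
  @isMeasurable.Build default_measure_display R[i] complex_measurable
    complex_measurable0 complex_measurableC complex_measurable_bigcup.

Lemma measurable_complex_of_pair : measurable_fun setT complex_of_pair.
Proof. by move=> _ A mA; rewrite setTI. Qed.

HB.instance Definition _ :=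
  isMeasurableFun.Build _ _ _ _ complex_of_pair measurable_complex_of_pair.

End complex_measurable.

(* CN(0,1): independent N(0,1/2) real and imaginary parts; the second argument
   of normal_prob is the standard deviation. *)
Definition complex_normal (R : realType) : probability R[i] R :=
  distribution (normal_prob (0 : R) (Num.sqrt 2^-1)
                \x normal_prob (0 : R) (Num.sqrt 2^-1))%E
               complex_of_pair.

Section iid.
Context {d : measure_display} {T : measurableType d} {R : realType}.

Definition cons_pair n (p : T * n.-tuple T) : n.+1.-tuple T :=
  [tuple of p.1 :: p.2].

Lemma measurable_cons_pair n : measurable_fun setT (@cons_pair n).
Proof. exact: measurable_cons. Qed.

HB.instance Definition _ n :=
  isMeasurableFun.Build _ _ _ _ (@cons_pair n) (@measurable_cons_pair n).

(* law of n independent draws from nu *)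
Fixpoint iid (nu : probability T R) n : probability (n.-tuple T) R :=
  match n with
  | 0 => dirac [tuple]
  | n'.+1 => distribution (nu \x iid nu n')%E (@cons_pair n')
  end.

End iid.

Definition mx_of_tuple (T : Type) m n (z : (m * n).-tuple T) : 'M[T]_(m, n) :=
  \matrix_(i, j) tnth z (mxvec_index i j).

(* entropy, in bits, of f(W) for W uniform on Om *)
Definition entropy {R : realType} (Om S : finType) (f : Om -> S) : R :=
  let p s := #|[set w | f w == s]%SET|%:R / #|Om|%:R in
  - \sum_(s : S) p s * log2 (p s).

Section fran.
Context {R : realType}.
(* M edge nodes, K users, N files *)
Variables M K N : nat.

Definition channel := 'M[R[i]]_(K, M).
Definition library L := {ffun 'I_N -> 'I_(2 ^ L)}.
Definition demand := {ffun 'I_K -> 'I_N}.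

(* Delivery phase for one channel realization.  S is the alphabet of the cached
   file parts, so that the content of one cache is a map 'I_N -> S; message is
   the alphabet of the fronthaul message of each edge node. *)
Record delivery (L : nat) (S : finType) := Delivery {
  fronthaul_time : nat;
  edge_time : nat;
  message : finType;
  fronthaul : 'I_M -> library L -> ('I_N -> S) -> demand -> message;
  edge : 'I_M -> ('I_N -> S) -> message -> demand -> 'rV[R[i]]_edge_time;
  decoder : 'I_K -> edge_time.-tuple R[i] -> 'I_N -> 'I_(2 ^ L) }.

(* Caching ignores the channel and the demand.  The whole delivery phase,
   including its durations, may depend on the channel, which is constant during
   the transmission and known to all nodes: with durations common to all
   channel realizations, no positive rate is feasible for almost all channels
   under, e.g., Rayleigh fading at a fixed power. *)
Record policy (L : nat) := Policy {
  cache_symbol : finType;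
  cache : 'I_M -> 'I_N -> 'I_(2 ^ L) -> cache_symbol;
  deliver : channel -> delivery L cache_symbol }.

Section one_policy.
Variables (L : nat) (p : policy L).

Definition cached (F : library L) (m : 'I_M) : 'I_N -> cache_symbol p :=
  fun n => cache p m n (F n).

Section given_channel.
Variable H : channel.
Let q := deliver p H.

Definition codeword (F : library L) (D : demand) (m : 'I_M) :
    'rV[R[i]]_(edge_time q) :=
  edge m (cached F m) (fronthaul q m F (cached F m) D) D.

Definition received (F : library L) (D : demand)
    (Z : 'M[R[i]]_(K, edge_time q)) : 'M[R[i]]_(K, edge_time q) :=
  H *m (\matrix_(m < M) codeword F D m) + Z.

Definition decoded (F : library L) (D : demand)
    (Z : 'M[R[i]]_(K, edge_time q)) (k : 'I_K) : 'I_(2 ^ L) :=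
  decoder k [tuple received F D Z k t | t < edge_time q] (D k).

(* probability, over uniform files and CN(0,1) noise, that user k errs *)
Definition user_error (D : demand) (k : 'I_K) : R :=
  \sum_(F : library L) #|library L|%:R^-1 *
    fine (iid (complex_normal R) (K * edge_time q)
            [set z | decoded F D (mx_of_tuple z) k <> F (D k)]).

Definition error_probability : R :=
  \big[Num.max/0]_(D : demand) \big[Num.max/0]_(k < K) user_error D k.

Definition codeword_power (F : library L) (D : demand) (m : 'I_M) : R :=
  (edge_time q)%:R^-1 *
    \sum_(t < edge_time q)
      (complex.Re (codeword F D m 0 t) ^+ 2
       + complex.Im (codeword F D m 0 t) ^+ 2).

End given_channel.

(* mu: fractional cache size, CF: fronthaul capacity, P: power *)
Definition admissible (mu CF P : R) : Prop :=
  (forall m n, entropy (cache p m n) <= mu * L%:R) /\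
  forall H : channel,
    [/\ #|message (deliver p H)|%:R
          <= 2 `^ ((fronthaul_time (deliver p H))%:R * CF),
        forall F D m, codeword_power H F D m <= P
      & forall k n w, measurable [set y | decoder (d := deliver p H) k y n = w]].

End one_policy.

Section ndt.
(* nu: common law of the channel coefficients *)
Variable nu : probability R[i] R.

Definition for_almost_all_channels (Q : channel -> Prop) : Prop :=
  {ae iid nu (K * M), forall h, Q (mx_of_tuple h)}.

Definition feasible (p : forall L, policy L) : Prop :=
  for_almost_all_channels (fun H =>
    error_probability (p L) H @[L --> \oo] --> (0 : R)).

(* The delivery time per bit is a function of the channel realization. *)
Definition achievable_delivery_time (mu CF P : R) (Delta : channel -> \bar R) :
    Prop :=
  exists p : forall L, policy L,
    [/\ forall L, admissible (p L) mu CF P,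
        feasible p
      & forall H, Delta H = limn_esup (fun L =>
          ((fronthaul_time (deliver (p L) H) + edge_time (deliver (p L) H))%:R
             / L%:R)%:E)].

(* The normalized delivery time is a constant, attained for almost all
   channels; log2 P > 0 restricts the power to P > 1. *)
Definition achievable_ndt (mu r : R) (delta : \bar R) : Prop :=
  exists Delta : R -> channel -> \bar R,
    (forall P, 1 < P -> achievable_delivery_time mu (r * log2 P) P (Delta P)) /\
    for_almost_all_channels (fun H =>
      (Delta P H * (log2 P)%:E)%E @[P --> +oo%R] --> delta).

Definition min_ndt (mu r : R) : \bar R :=
  ereal_inf [set delta | achievable_ndt mu r delta].

End ndt.

End fran.

(* soft-transfer NDT of cloud-aided delivery, with K / (M r) = +oo at r = 0 *)
Definition ndt_cl_sf {R : realType} (M K : nat) (r : R) : \bar R :=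
  ((K%:R / (minn M K)%:R)%:E +
   (if (r == 0)%R then +oo else (K%:R / (M%:R * r))%:E))%E.

(* Main.v *)
Require Import Defs.
From mathcomp Require Import all_boot all_order all_algebra.
From mathcomp Require Import all_classical all_reals all_analysis.
From mathcomp Require Import measurable_realfun complex ring lra zify.

(* Soft-transfer zero forcing, with m = min(M, K) and empty caches.  Each file is
   encoded by a Hamming code of large minimum distance over a square grid of
   points of bounded spacing, and m users are served at a time by m edge nodes,
   cyclically.  The cloud inverts the m x m channel minor and sends the precoded
   symbols, rounded to unit precision, to the edge nodes: about log P bits per
   symbol.  Rounding and all but a fraction p of the noise samples stay below
   half the spacing, so a user errs only if more than T/v of its T symbols are
   hit; by a union bound this has probability at most 2^T p^(T/v), which vanishes
   once p <= 4^-v.  The Gilbert-Varshamov bound gives codes with this distance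
   whose rate is within a factor (v-4)/v of log P, and the factor v/(v-4)
   disappears in the infimum over v.  Minors are invertible for almost every
   channel, because a determinant is affine in each entry and the coefficients
   have no atoms. *)

Set Implicit Arguments.
Unset Strict Implicit.
Unset Printing Implicit Defensive.

Import Order.TTheory GRing.Theory Num.Theory.
Import numFieldNormedType.Exports.
Local Open Scope classical_set_scope.
Local Open Scope complex_scope.
Local Open Scope ring_scope.

(** * Independent draws *)

Section iid_lemmas.
Context {d : measure_display} {T : measurableType d} {R : realType}.
Variable nu : probability T R.

Lemma iidS n (A : set (n.+1.-tuple T)) :
  iid nu n.+1 A = (nu \x iid nu n)%E (@cons_pair d T n @^-1` A).
Proof. by []. Qed.

Lemma measurable_tuple_rect n (B : 'I_n -> set T) :
  (forall i, measurable (B i)) ->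
  measurable [set z : n.-tuple T | forall i, B i (tnth z i)].
Proof.
move=> mB.
rewrite (_ : [set z | _] =
    \bigcap_(i in [set: 'I_n]) ((fun z : n.-tuple T => tnth z i) @^-1` B i)).
  apply: fin_bigcap_measurable => [|i _]; first exact: finite_finset.
  by rewrite -[X in measurable X]setTI; exact: measurable_tnth.
by apply/seteqP; split=> z /= h i; [move=> _; exact: h|exact: h].
Qed.

Lemma iid_rect n (B : 'I_n -> set T) : (forall i, measurable (B i)) ->
  (iid nu n [set z | forall i, B i (tnth z i)] = \prod_(i < n) nu (B i))%E.
Proof.
elim: n B => [|n IH] B mB.
  rewrite big_ord0 /= diracE mem_set//; by case.
rewrite iidS big_ord_recl -IH; last by move=> i; exact: mB.
rewrite -product_measure1E; first last.
- by apply: (@measurable_tuple_rect _ (fun i => B (lift ord0 i))) => i; exact: mB.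
- exact: mB.
congr (product_measure1 _ _ _); apply/seteqP; split => -[x z] /=.
  move=> h; split; first by have := h ord0; rewrite /cons_pair tnth0.
  by move=> i; have := h (lift ord0 i); rewrite /cons_pair tnthS.
move=> [h0 hS] i; case: (unliftP ord0 i) => [j ->|->].
  by rewrite /cons_pair tnthS.
by rewrite /cons_pair tnth0.
Qed.

(** Lines in direction [j] meet [E] in at most one point and [nu] has no atoms, so Fubini gives
    measure 0. The induction peels off first coordinates until [j] comes first. *)
Lemma iid_graph_null n (j : 'I_n) (E : set (n.-tuple T)) :
  (forall z, nu [set z] = 0%E) -> measurable E ->
  (forall z z', E z -> E z' ->
    (forall i, i != j -> tnth z i = tnth z' i) -> z = z') ->
  iid nu n E = 0%E.
Proof.
move=> nu0; elim: n j E => [[]//|n IH] j E mE gE.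
rewrite iidS.
have mE' : measurable (@cons_pair d T n @^-1` E).
  by rewrite -[X in measurable X]setTI; exact: measurable_cons_pair.
case: (unliftP ord0 j) => [k jE|j0].
  rewrite /product_measure1 /=; apply: integral0_eq => x _ /=.
  apply: (IH k); first exact: measurable_xsection.
  move=> z z'; rewrite /xsection/= !inE /= => Ez Ez' zz'.
  have: cons_pair (x, z) = cons_pair (x, z').
    apply: gE => // i ij; case: (unliftP ord0 i) => [l il|->].
      rewrite il /cons_pair !tnthS zz'//.
      by apply: contra_neq ij => lk; rewrite il lk jE.
    by rewrite /cons_pair !tnth0.
  by move/(congr1 val) => [] /val_inj.
(* Now the first coordinate has to be integrated first, so the product measure is rewritten as the
   iterated integral in the opposite order. *)
rewrite (@product_measure_unique _ _ _ _ _ nu (iid nu n) (nu \x^ iid nu n)%E)//; last first.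
  by move=> A B mA mB; exact: product_measure2E.
rewrite /product_measure2 /=; apply: integral0_eq => z _ /=.
have [/eqP ->|/set0P[x0 sx0]] := boolP (ysection (@cons_pair d T n @^-1` E) z == set0).
  by rewrite measure0.
rewrite (_ : ysection _ _ = [set x0])//.
apply/seteqP; split=> x /=; last by move=> ->.
move: sx0; rewrite /ysection/= !inE /= => Ex0 Ex.
have: cons_pair (x, z) = cons_pair (x0, z).
  apply: gE => // i; rewrite j0 => ij; case: (unliftP ord0 i) ij => [l -> _|-> /eqP//].
  by rewrite /cons_pair !tnthS.
by move/(congr1 val) => [].
Qed.

End iid_lemmas.

(** Union bound over the at most [2 ^ #|J|] subsets [S] of [J] with at least [k] elements. The
    samples in [S] are all bad with probability at most [c ^+ #|S|], which is at most [c ^+ k] as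
    [c <= 1]. *)
Lemma iid_many_bad d (T : measurableType d) (R : realType)
    (nu : probability T R) n (J : {set 'I_n}) (B : set T) (k : nat) (c : R)
    (E : set (n.-tuple T)) :
  measurable B -> (nu B <= c%:E)%E -> c <= 1 -> measurable E ->
  (forall z, E z -> exists S : {set 'I_n},
     [/\ S \subset J, (k <= #|S|)%N & forall i, i \in S -> B (tnth z i)]) ->
  (iid nu n E <= (2 ^+ #|J| * c ^+ k)%:E)%E.
Proof.
move=> mB nuB c1 mE EB.
have c0 : 0 <= c by rewrite -lee_fin (le_trans _ nuB).
pose F (S : {set 'I_n}) : set (n.-tuple T) :=
  [set z | forall i, (if i \in S then B else setT) (tnth z i)].
have mF S : measurable (F S).
  apply: (@measurable_tuple_rect _ _ _ (fun i => if i \in S then B else setT)).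
  by move=> i; case: ifP.
pose P := [pred S : {set 'I_n} | (S \subset J) && (k <= #|S|)%N].
have EF : E `<=` \big[setU/set0]_(S | P S) F S.
  move=> z /EB[S [SJ Sk SB]]; rewrite (bigD1 S)/=; last by rewrite SJ Sk.
  by left => i; case: ifPn => // iS; exact: SB.
apply: (@le_trans _ _ (iid nu n (\big[setU/set0]_(S | P S) F S))).
  apply: le_measure => //; rewrite inE//.
  exact: bigsetU_measurable.
apply: (@le_trans _ _ (\sum_(S | P S) iid nu n (F S))%E).
  have mU r : measurable (\big[setU/set0]_(S <- r | P S) F S).
    exact: bigsetU_measurable.
  elim: (index_enum _) => [|S r IH]; first by rewrite !big_nil measure0.
  rewrite !big_cons; case: ifP => // PS.
  by apply: le_trans (leeD2l _ IH); exact: measureU2.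
apply: (@le_trans _ _ (\sum_(S | P S) (c ^+ k)%:E)%E).
  apply: lee_sum => S /andP[_ Sk].
  rewrite (@iid_rect _ _ _ _ _ (fun i => if i \in S then B else setT)); last first.
    by move=> i; case: ifP.
  rewrite (bigID (mem S))/= [X in (_ * X)%E]big1 ?mule1; last first.
    by move=> i /negbTE ->; rewrite probability_setT.
  apply: (@le_trans _ _ (c ^+ #|S|)%:E); last by rewrite lee_fin ler_wiXn2l.
  rewrite -prodr_const -prodEFin.
  suff : (0 <= \prod_(i in S) nu (if i \in S then B else setT) <=
          \prod_(i in S) c%:E)%E by case/andP.
  elim/big_ind2 : _ => [|x1 x2 y1 y2 /andP[x0 xy] /andP[y0 yy]|i iS].
  - by rewrite lexx lee_fin ler01.
  - by rewrite mule_ge0// lee_pmul.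
  - by rewrite iS measure_ge0.
rewrite sumEFin lee_fin sumr_const -[leLHS]mulr_natl ler_wpM2r ?exprn_ge0//.
rewrite -natrX ler_nat -card_powerset; apply/subset_leq_card/fintype.subsetP => S.
by rewrite powersetE => /andP[].
Qed.

(** The set depends on [x] only through a finite membership pattern, so it is a finite union of
    intersections of the [E i] and their complements, whatever [Q] is. *)
Lemma measurable_bool_family d (X : measurableType d) (I : finType)
    (E : I -> set X) (Q : {set I} -> Prop) :
  (forall i, measurable (E i)) ->
  measurable [set x | Q [set i | `[< E i x >]]%SET].
Proof.
move=> mE.
rewrite (_ : [set x | _] =
  \bigcup_(v in Q) \bigcap_(i in [set: I]) (if i \in v then E i else ~` E i)).
  apply: fin_bigcup_measurable => [|v _].
    exact: (@finite_finset _ Q).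
  apply: fin_bigcap_measurable => [|i _]; first exact: finite_finset.
  by case: ifP => // _; exact: measurableC.
apply/seteqP; split=> x /=.
  move=> Qx; exists [set i | `[< E i x >]]%SET => // i _.
  by rewrite inE; case: asboolP.
move=> [v Qv vE]; suff -> : [set i | `[< E i x >]]%SET = v by [].
apply/setP => i; rewrite inE; have := vE i Logic.I.
by case: (i \in v) => h; [exact/asboolP|exact/asboolP].
Qed.

(** * Measurable boxes in the complex plane and tightness *)

Section complex_measurability.
Context {R : realType}.

Lemma measurable_Re :
  measurable_fun [set: R[i]] (@complex.Re R : _ -> measurableTypeR R).
Proof.
move=> _ A mA; rewrite setTI.
rewrite /measurable/= /complex_measurable/=.
rewrite -[X in measurable X]setTI.
exact: (@measurable_fst _ _ (measurableTypeR R) (measurableTypeR R)).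
Qed.

Lemma measurable_Im :
  measurable_fun [set: R[i]] (@complex.Im R : _ -> measurableTypeR R).
Proof.
move=> _ A mA; rewrite setTI.
rewrite /measurable/= /complex_measurable/=.
rewrite -[X in measurable X]setTI.
exact: (@measurable_snd _ _ (measurableTypeR R) (measurableTypeR R)).
Qed.

(** Squares match the square grid: they serve both as the region of harmless noise and as decision
    cells. *)
Definition box (a b r : R) : set R[i] :=
  [set z | `|complex.Re z - a| < r /\ `|complex.Im z - b| < r].

Lemma measurable_box a b r : measurable (box a b r).
Proof.
rewrite (_ : box a b r = (@complex.Re R @^-1` [set x | `|x - a| < r]) `&`
  (@complex.Im R @^-1` [set x | `|x - b| < r])) //.
have mb (a' : R) : measurable ([set x | `|x - a'| < r] : set (measurableTypeR R)).
  rewrite (_ : [set x | _] = `]a' - r, a' + r[%classic) //.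
  by apply/seteqP; split => x /=; rewrite in_itv/= ltr_distl.
apply: measurableI; rewrite -[X in measurable X]setTI.
  exact: measurable_Re.
exact: measurable_Im.
Qed.

(** The complements of growing boxes decrease to the empty set, so their measures tend to 0. *)
Lemma box_tight (nu : probability R[i] R) (k : R) : 0 < k ->
  exists2 r : R, 0 < r & (nu (~` box 0 0 r) <= k%:E)%E.
Proof.
move=> k0.
pose F n := ~` box 0 0 (n%:R : R).
have mF n : measurable (F n) by apply: measurableC; exact: measurable_box.
have F0 : \bigcap_n F n = set0.
  apply/seteqP; split=> // z /= Fz.
  pose n := (Num.truncn (`|complex.Re z| + `|complex.Im z|)).+1.
  have h : `|complex.Re z| + `|complex.Im z| < n%:R by exact: truncnS_gt.
  apply: (Fz n I); rewrite /box/= !subr0; split.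
    by apply: le_lt_trans h; rewrite lerDl.
  by apply: le_lt_trans h; rewrite lerDr.
have := @nonincreasing_cvg_mu _ _ _ nu F _ mF.
rewrite F0 measure0 => cF.
have {}cF : nu \o F @ \oo --> 0%E.
  apply: cF => //.
    by rewrite (le_lt_trans (probability_le1 _ _)) ?ltry.
  move=> m n mn; apply/subsetPset => z /= h [h1 h2]; apply: h; split.
    by apply: (lt_le_trans h1); rewrite ler_nat.
  by apply: (lt_le_trans h2); rewrite ler_nat.
have /cF : nbhs (0%E : \bar R) [set x | (x <= k%:E)%E].
  apply: (@filterS _ _ _ [set x | (x < k%:E)%E]); first by move=> x /ltW.
  by apply: open_nbhs_nbhs; split; [exact: open_ereal_lt_ereal|rewrite /= lte_fin].
move=> [N _ hN]; exists N.+1%:R => //.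
by have := hN N.+1 (leqnSn N).
Qed.

End complex_measurability.

(** * Almost every channel has invertible minors *)

Section generic_channel.
Context {R : realType}.

Lemma Re_add (x y : R[i]) : complex.Re (x + y) = complex.Re x + complex.Re y.
Proof. by case: x y => [a b] [c e]. Qed.

Lemma Im_add (x y : R[i]) : complex.Im (x + y) = complex.Im x + complex.Im y.
Proof. by case: x y => [a b] [c e]. Qed.

Lemma Re_mul (x y : R[i]) : complex.Re (x * y) =
  complex.Re x * complex.Re y - complex.Im x * complex.Im y.
Proof. by case: x y => [a b] [c e]. Qed.

Lemma Im_mul (x y : R[i]) : complex.Im (x * y) =
  complex.Re x * complex.Im y + complex.Im x * complex.Re y.
Proof. by case: x y => [a b] [c e]. Qed.

(** Stated by real coordinates, so that sums and products reduce to real ones;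
    [cmeasurable_measurable] leads back to the sigma-algebra of [R[i]]. *)
Definition cmeasurable d (X : measurableType d) (f : X -> R[i]) : Prop :=
  measurable_fun setT (fun x => complex.Re (f x) : measurableTypeR R) /\
  measurable_fun setT (fun x => complex.Im (f x) : measurableTypeR R).

Section cmeasurable.
Context d (X : measurableType d).
Implicit Types f g : X -> R[i].

Lemma cmeasurable_cst c : cmeasurable (fun _ : X => c).
Proof. by split; exact: measurable_cst. Qed.

Lemma cmeasurableD f g : cmeasurable f -> cmeasurable g ->
  cmeasurable (fun x => f x + g x).
Proof.
move=> [f1 f2] [g1 g2]; split.
  under eq_fun do rewrite Re_add; exact: measurable_funD.
under eq_fun do rewrite Im_add; exact: measurable_funD.
Qed.

Lemma cmeasurableM f g : cmeasurable f -> cmeasurable g ->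
  cmeasurable (fun x => f x * g x).
Proof.
move=> [f1 f2] [g1 g2]; split.
  under eq_fun do rewrite Re_mul.
  by apply: measurable_funB; exact: measurable_funM.
under eq_fun do rewrite Im_mul.
by apply: measurable_funD; exact: measurable_funM.
Qed.

Lemma cmeasurable_sum (I : Type) (r : seq I) (h : I -> X -> R[i]) :
  (forall i, cmeasurable (h i)) -> cmeasurable (fun x => \sum_(i <- r) h i x).
Proof.
move=> mh; elim: r => [|i r IH].
  under eq_fun do rewrite big_nil; exact: cmeasurable_cst.
under eq_fun do rewrite big_cons; exact: cmeasurableD.
Qed.

Lemma cmeasurable_prod (I : Type) (r : seq I) (h : I -> X -> R[i]) :
  (forall i, cmeasurable (h i)) -> cmeasurable (fun x => \prod_(i <- r) h i x).
Proof.
move=> mh; elim: r => [|i r IH].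
  under eq_fun do rewrite big_nil; exact: cmeasurable_cst.
under eq_fun do rewrite big_cons; exact: cmeasurableM.
Qed.

Lemma cmeasurable_det n (A : X -> 'M[R[i]]_n) :
  (forall i j, cmeasurable (fun x => A x i j)) ->
  cmeasurable (fun x => \det (A x)).
Proof.
move=> mA; apply: cmeasurable_sum => s; apply: cmeasurableM.
  exact: cmeasurable_cst.
exact: cmeasurable_prod.
Qed.

Lemma measurable_eq0 f : cmeasurable f -> measurable [set x | f x = 0].
Proof.
move=> [f1 f2].
rewrite (_ : [set x | _] = ((fun x => complex.Re (f x)) @^-1` [set 0]) `&`
  ((fun x => complex.Im (f x)) @^-1` [set 0])).
  apply: measurableI; rewrite -[X in measurable X]setTI.
    by apply: f1 => //; exact: measurable_set1.
  by apply: f2 => //; exact: measurable_set1.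
apply/seteqP; split=> x /=; first by move=> ->.
by case: (f x) => a b /= [-> ->].
Qed.

Lemma cmeasurable_measurable f : cmeasurable f -> measurable_fun setT f.
Proof.
move=> [f1 f2] _ A mA; rewrite setTI.
have := measurable_fun_pair f1 f2 measurableT mA; rewrite setTI.
rewrite (_ : _ @^-1` (complex_of_pair @^-1` A) = f @^-1` A)//.
by apply/seteqP; split=> x /=; rewrite /complex_of_pair/=; case: (f x).
Qed.

End cmeasurable.

Lemma cmeasurable_tnth n (i : 'I_n) :
  cmeasurable (fun z : n.-tuple R[i] => tnth z i).
Proof.
split.
  apply: (@measurableT_comp _ _ _ _ _ _ _ _ _ measurable_Re).
  exact: measurable_tnth.
apply: (@measurableT_comp _ _ _ _ _ _ _ _ _ measurable_Im).
exact: measurable_tnth.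
Qed.

(** Expansion along the first row makes the determinant affine in the corner entry, with the minor
    as slope; a nonzero slope leaves a single root. *)
Lemma det_entry_unique (F : fieldType) n (A B : 'M[F]_n.+1) :
  (forall i j, (i, j) != (0, 0) -> A i j = B i j) ->
  \det (mxsub (lift ord0) (lift ord0) A) != 0 ->
  \det A = 0 -> \det B = 0 -> A = B.
Proof.
move=> AB minor0 A0 B0.
have cofE j : cofactor B 0 j = cofactor A 0 j.
  rewrite /cofactor; congr (_ * \det _); apply/matrixP => i k.
  by rewrite !mxE AB// xpair_eqE negb_and eq_sym neq_lift.
have : (A 0 0 - B 0 0) * cofactor A 0 0 = \det A - \det B.
  rewrite (expand_det_row A 0) (expand_det_row B 0) -sumrB big_ord_recl/=.
  rewrite cofE mulrBl big1 ?addr0// => j _.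
  by rewrite cofE AB ?subrr// xpair_eqE negb_and eq_sym neq_lift.
rewrite A0 B0 subr0 => /eqP; rewrite mulf_eq0 => /orP[|].
  rewrite subr_eq0 => /eqP A00; apply/matrixP => i j.
  by have [[-> ->]//|ij] := eqVneq (i, j) (0, 0); exact: AB.
rewrite /cofactor addn0 expr0 mul1r => /eqP m0; case/eqP: minor0; rewrite -m0.
by congr (\det _); apply/matrixP => i j; rewrite !mxE.
Qed.

(** Induction on the size of the minor. Where the smaller minor is nonzero, the zero set of the
    determinant is a graph over the entries other than [(f 0, g 0)], hence null. *)
Lemma ae_minor_neq0 (nu : probability R[i] R) K M n
    (f : 'I_n -> 'I_K) (g : 'I_n -> 'I_M) :
  (forall z : R[i], nu [set z] = 0%E) -> injective f -> injective g ->
  {ae iid nu (K * M), forall h, \det (mxsub f g (mx_of_tuple h)) != 0}.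
Proof.
move=> nu0; elim: n f g => [|n IH] f g fi gi.
  by apply: filterE => h; rewrite det_mx00 oner_eq0.
have lift_inj2 : injective (lift (@ord0 n)) by exact: lift_inj.
have IHfg := IH _ _ (inj_comp fi lift_inj2) (inj_comp gi lift_inj2).
pose minor (h : (K * M).-tuple R[i]) :=
  mxsub (f \o lift ord0) (g \o lift ord0) (mx_of_tuple h).
pose E := ~` [set h | \det (minor h) = 0] `&`
          [set h | \det (mxsub f g (mx_of_tuple h)) = 0].
have mE : measurable E.
  apply: measurableI.
    apply/measurableC/measurable_eq0/cmeasurable_det => i j.
    by under eq_fun do rewrite /minor !mxE; exact: cmeasurable_tnth.
  apply/measurable_eq0/cmeasurable_det => i j.
  by under eq_fun do rewrite !mxE; exact: cmeasurable_tnth.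
have E0 : iid nu (K * M) E = 0%E.
  apply: (@iid_graph_null _ _ _ _ _ (mxvec_index (f 0) (g 0))) => //.
  move=> z z' [] /= /eqP m0 d0 [_ d0'] zz'.
  (* By injectivity of [f] and [g], the varying coordinate enters the minor only at position
     [(0, 0)]. *)
  have zE i j : (i, j) != (0, 0) ->
      mxsub f g (mx_of_tuple z) i j = mxsub f g (mx_of_tuple z') i j.
    move=> ij; rewrite !mxE; apply: zz'; apply: contra_neq ij.
    by rewrite /mxvec_index => /cast_ord_inj /enum_rank_inj [/fi -> /gi ->].
  have eqA := det_entry_unique zE _ d0 d0'.
  have {}eqA : mxsub f g (mx_of_tuple z) = mxsub f g (mx_of_tuple z').
    apply: eqA; apply: contra_neq m0 => <-; rewrite /minor.
    by congr (\det _); apply/matrixP => i j; rewrite !mxE.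
  apply: eq_from_tnth => l.
  have [->|] := eqVneq l (mxvec_index (f 0) (g 0)); last exact: zz'.
  by move/matrixP : eqA => /(_ 0 0); rewrite !mxE.
have nE : {ae iid nu (K * M), forall h, ~ E h}.
  exists E; split => //; by move=> h /= /contrapT.
near=> h.
apply/negP => /eqP d0.
have : ~ E h by near: h.
apply; split => //=; apply/eqP.
by near: h.
Unshelve. all: by end_near.
Qed.

End generic_channel.

(** * Hamming codes *)

Definition hamming (I A : finType) (x y : {ffun I -> A}) : nat :=
  #|[set s | x s != y s]%SET|.

Lemma hamming_sym (I A : finType) (x y : {ffun I -> A}) :
  hamming x y = hamming y x.
Proof. by apply: eq_card => s; rewrite !inE eq_sym. Qed.

(** A point of the ball agrees with [x] off a set [S] of at most [d] positions; each [S] leaves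
    [#|A| ^ #|S|] points, and [2 ^ #|I|] bounds the number of sets. *)
Lemma card_hamming_ball (I A : finType) (x : {ffun I -> A}) (d : nat) :
  (0 < #|A|)%N ->
  (#|[set y | (hamming x y <= d)%N]%SET| <= 2 ^ #|I| * #|A| ^ d)%N.
Proof.
move=> A0.
pose fam (S : {set I}) : {pred {ffun I -> A}} :=
  family (fun s => if s \in S then predT else pred1 (x s)).
have card_fam S : #|fam S| = (#|A| ^ #|S|)%N.
  rewrite card_family foldrE big_map big_enum/=.
  rewrite (bigID (mem S))/= [X in (_ * X)%N]big1 ?muln1; last first.
    by move=> s /negbTE ->; rewrite card1.
  by rewrite (eq_bigr (fun=> #|A|)) ?prod_nat_const// => s ->; exact: eq_card.
have ball_fam y : y \in [set y | (hamming x y <= d)%N]%SET ->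
    (1 <= \sum_(S : {set I} | (#|S| <= d)%N) (y \in fam S))%N.
  rewrite inE => xy; rewrite (bigD1 [set s | x s != y s]%SET)//=.
  suff -> : y \in fam [set s | x s != y s]%SET by [].
  apply/familyP => s; rewrite inE; case: ifP => [//|/negbFE/eqP ->].
  by rewrite inE.
rewrite -sum1_card; 
apply: (@leq_trans (\sum_(y in [set y | (hamming x y <= d)%N]%SET)
    \sum_(S : {set I} | (#|S| <= d)%N) (y \in fam S))%N).
  exact: leq_sum.
rewrite exchange_big/=.
apply: (@leq_trans (\sum_(S : {set I} | (#|S| <= d)%N) #|A| ^ d)%N).
  apply: leq_sum => S Sd; apply: (@leq_trans #|fam S|).
    rewrite -sum1_card [leqRHS]big_mkcond/= big_mkcond/= leq_sum// => y _.
    by case: ifP => //; case: (y \in fam S).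
  by rewrite card_fam leq_pexp2l.
rewrite sum_nat_const leq_mul2r -[X in (_ <= 2 ^ X)%N]cardsT -card_powerset.
by apply/orP; right; apply/subset_leq_card/fintype.subsetP => S _;
  rewrite powersetE finset.subsetT.
Qed.

(* Gilbert-Varshamov: pick the codewords greedily outside the Hamming balls
   around the previous ones. *)
Lemma gilbert_varshamov (I A : finType) (d n : nat) : (0 < #|A|)%N ->
  (n * (2 ^ #|I| * #|A| ^ d) <= #|A| ^ #|I|)%N ->
  exists c : 'I_n -> {ffun I -> A},
    forall w w', w != w' -> (d < hamming (c w) (c w'))%N.
Proof.
move=> A0; set V := (_ * _ ^ d)%N.
have V0 : (0 < V)%N by rewrite muln_gt0 !expn_gt0 A0.
elim: n => [|n IH] nV.
  have c0 : 'I_0 -> {ffun I -> A} by case.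
  by exists c0 => -[].
have [|c cP] := IH; first by apply: leq_trans nV; rewrite leq_mul2r leqnSn orbT.
pose U := (\bigcup_(w : 'I_n) [set y | (hamming (c w) y <= d)%N])%SET.
have cU : (#|U| <= n * V)%N.
  rewrite -[X in (_ <= X * _)%N](card_ord n) -sum_nat_const.
  rewrite /U; elim/big_ind2 : _ => [|m1 S1 m2 S2 h1 h2|w _].
  - by rewrite cards0.
  - by rewrite (leq_trans (leq_card_setU _ _))// leq_add.
  - exact: card_hamming_ball.
have [y yU] : exists y, y \notin U.
  apply/existsP; rewrite -negb_forall; apply/negP => /forallP h.
  have : (#|{ffun I -> A}| <= #|U|)%N.
    by apply/subset_leq_card/fintype.subsetP => y _; exact: h.
  rewrite card_ffun leqNgt => /negP; apply.
  apply: (leq_ltn_trans cU); apply: leq_trans nV.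
  by rewrite ltn_mul2r V0 ltnSn.
have yP w : (d < hamming (c w) y)%N.
  rewrite ltnNge; apply: contra yU => h; apply/finset.bigcupP.
  by exists w => //; rewrite inE.
exists (fun w => if unlift ord_max w is Some v then c v else y) => w w'.
case: (unliftP ord_max w) => [v ->|->]; case: (unliftP ord_max w') => [v' ->|->].
- by rewrite (inj_eq lift_inj) => /cP.
- by [].
- by rewrite hamming_sym.
- by rewrite eqxx.
Qed.

(** * The transmission scheme *)

Section scheme.
Context {R : realType}.
Variables (K' M' N m L tau B q n d : nat) (g : R).
Hypotheses (mK : (m <= K'.+1)%N) (mM : (m <= M'.+1)%N).
Variable code : 'I_(2 ^ L) -> {ffun 'I_m * 'I_M'.+1 * 'I_tau -> 'I_q * 'I_q}.
Variable H : 'M[R[i]]_(K'.+1, M'.+1).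

Local Notation K := K'.+1.
Local Notation M := M'.+1.

(** Addition in ['I_K] is modulo [K]: shift [a] serves [m] cyclically consecutive users, and each
    user is served under [m] shifts. *)
Definition active_user (a : 'I_K) (i : 'I_m) : 'I_K := a + widen_ord mK i.
Definition active_node (b : 'I_M) (j : 'I_m) : 'I_M := b + widen_ord mM j.

Lemma active_user_inj a : injective (active_user a).
Proof. by move=> i j /addrI /(congr1 val) /= ij; exact: val_inj. Qed.

Lemma active_node_inj b : injective (active_node b).
Proof. by move=> i j /addrI /(congr1 val) /= ij; exact: val_inj. Qed.

(* The first component pads the schedule: only its value 0 is used. *)
Definition slot := ('I_B.+1 * ('I_K * 'I_M * 'I_tau))%type.

Definition active_minor (a : 'I_K) (b : 'I_M) : 'M[R[i]]_m :=
  mxsub (active_user a) (active_node b) H.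

Definition point (u : 'I_q * 'I_q) : R[i] :=
  (g * u.1%:R) +i* (g * u.2%:R).

Definition target (F : library N L) (D : demand K N) a b t : 'cV[R[i]]_m :=
  \col_i point (code (F (D (active_user a i))) (i, b, t)).

Definition precoded F D a b t : 'cV[R[i]]_m :=
  invmx (active_minor a b) *m target F D a b t.

(** Index of a unit cell in the interval of length [n.+1] centred at 0, whose lower end is returned
    by [level]. Outside the interval the result is a mere default. *)
Definition quantize (x : R) : 'I_n.+1 := inord (Num.truncn (x + n.+1%:R / 2)).
Definition level (j : 'I_n.+1) : R := j%:R - n.+1%:R / 2.

Definition quantized_signal (c : 'I_n.+1 * 'I_n.+1) : R[i] :=
  level c.1 +i* level c.2.

(** Node [e] holds position [j] exactly under the shift [b = e - j], so the triples [(j, a, t)]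
    already list all its active slots. *)
Definition soft_fronthaul (e : 'I_M) (F : library N L) (_ : 'I_N -> unit)
    (D : demand K N) : {ffun 'I_m * 'I_K * 'I_tau -> 'I_n.+1 * 'I_n.+1} :=
  [ffun s => let: (j, a, t) := s in
     let x := precoded F D a (e - widen_ord mM j) t j 0 in
     (quantize (complex.Re x), quantize (complex.Im x))].

(** At most one [j] contributes, by injectivity of [active_node b]; the empty sum is the silence of
    an inactive node. *)
Definition signal (e : 'I_M)
    (msg : {ffun 'I_m * 'I_K * 'I_tau -> 'I_n.+1 * 'I_n.+1}) a b t : R[i] :=
  \sum_(j | active_node b j == e) quantized_signal (msg (j, a, t)).

Definition soft_edge (e : 'I_M) (_ : 'I_N -> unit)
    (msg : {ffun 'I_m * 'I_K * 'I_tau -> 'I_n.+1 * 'I_n.+1})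
    (_ : demand K N) : 'rV[R[i]]_(#|{: slot}|) :=
  \row_s let: (p, (a, b, t)) := enum_val s in
         if p == 0 then signal e msg a b t else 0.

(** User [k] holds position [i] exactly under the shift [a = k - i]; coordinate [(i, b, t)] of its
    codeword is read off that slot. *)
Definition user_slot (k : 'I_K) (s : 'I_m * 'I_M * 'I_tau) : 'I_(#|{: slot}|) :=
  let: (i, b, t) := s in enum_rank ((0, (k - widen_ord mK i, b, t)) : slot).

Definition cell (u : 'I_q * 'I_q) : set R[i] :=
  box (g * u.1%:R) (g * u.2%:R) (g / 2).

Definition mismatches (k : 'I_K) (y : #|{: slot}|.-tuple R[i]) (w : 'I_(2 ^ L)) :=
  [set s | ~~ `[< cell (code w s) (tnth y (user_slot k s)) >]]%SET.

Definition first_file : 'I_(2 ^ L) :=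
  Ordinal (etrans (expn_gt0 2 L) isT).

(** Bounded-distance decoding; [first_file] is returned when no codeword is close enough. *)
Definition soft_decoder (k : 'I_K) (y : #|{: slot}|.-tuple R[i]) (_ : 'I_N)
    : 'I_(2 ^ L) :=
  odflt first_file [pick w | (#|mismatches k y w| <= d)%N].

Definition soft_delivery (T : nat) : @delivery R M K N L unit :=
  Delivery T soft_fronthaul soft_edge soft_decoder.

(** The delivery is tuned to the fixed [H] whatever the actual channel is, and its error is
    estimated at [H] only. Channel-dependent policies are assembled later. *)
Definition soft_policy (T : nat) : @policy R M K N L :=
  @Policy R M K N L unit (fun _ _ _ => tt) (fun _ => soft_delivery T).

Lemma user_slot_inj k : injective (user_slot k).
Proof.
move=> [[i b] t] [[i' b'] t'] /enum_rank_inj /pair_equal_spec[_].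
move=> /pair_equal_spec[/pair_equal_spec[e ->] ->].
congr (_, _, _); apply: val_inj.
by have /oppr_inj/(congr1 val) := addrI _ e.
Qed.

(** The decoder consults finitely many events, each saying that a given sample lies in a given
    cell. *)
Lemma measurable_soft_decoder k x w :
  measurable [set y | soft_decoder k y x = w].
Proof.
pose E (c : 'I_m * 'I_M * 'I_tau * ('I_q * 'I_q)) :
    set (#|{: slot}|.-tuple R[i]) :=
  [set y | cell c.2 (tnth y (user_slot k c.1))].
pose Q (v : {set 'I_m * 'I_M * 'I_tau * ('I_q * 'I_q)}) :=
  odflt first_file [pick w | (#|[set s | (s, code w s) \notin v]%SET| <= d)%N] = w.
rewrite (_ : [set y | _] = [set y | Q [set c | `[< E c y >]]%SET]).
  apply: measurable_bool_family => c.
  rewrite -[X in measurable X]setTI.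
  exact: (@measurable_tnth _ _ _ (user_slot k c.1) measurableT _ (measurable_box _ _ _)).
apply/seteqP; split=> y /=; rewrite /Q /soft_decoder.
  move=> <-; congr odflt; apply: eq_pick => v; congr (_ <= _)%N.
  by apply: eq_card => s; rewrite !inE.
move=> <-; congr odflt; apply: eq_pick => v; congr (_ <= _)%N.
by apply: eq_card => s; rewrite !inE.
Qed.

(** A real-valued submultiplicative norm that dominates both coordinates, which are what a box
    constrains. *)
Definition l1norm (z : R[i]) : R := `|complex.Re z| + `|complex.Im z|.

Lemma l1norm_ge0 z : 0 <= l1norm z. Proof. by rewrite addr_ge0. Qed.

Lemma l1normD y z : l1norm (y + z) <= l1norm y + l1norm z.
Proof.
rewrite /l1norm Re_add Im_add addrACA lerD// ler_normD//.
Qed.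

Lemma l1normM y z : l1norm (y * z) <= l1norm y * l1norm z.
Proof.
rewrite /l1norm Re_mul Im_mul.
apply: (le_trans (lerD (ler_normB _ _) (ler_normD _ _))).
by rewrite !normrM; lra.
Qed.

Lemma l1norm_sum (I : Type) (r : seq I) (P : pred I) (f : I -> R[i]) :
  l1norm (\sum_(i <- r | P i) f i) <= \sum_(i <- r | P i) l1norm (f i).
Proof.
elim/big_ind2 : _ => [|x1 x2 y1 y2 h1 h2|//]; first by rewrite /l1norm /= normr0 addr0.
by apply: (le_trans (l1normD _ _)); exact: lerD.
Qed.

(** In each coordinate the two grid points are less than [g] apart, so their indices are integers at
    distance below 1. *)
Lemma cell_inj (g0 : 0 < g) u v y : cell u y -> cell v y -> u = v.
Proof.
have coord (i j : 'I_q) (r : R) :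
    `|r - g * i%:R| < g / 2 -> `|r - g * j%:R| < g / 2 -> i = j.
  move=> ri rj; apply: val_inj => /=; apply/eqP; rewrite -(eqr_nat R).
  have : `|g * (i%:R - j%:R)| < g.
    rewrite (_ : g * _ = (r - g * j%:R) - (r - g * i%:R)); last by ring.
    by apply: (le_lt_trans (ler_normB _ _)); lra.
  rewrite normrM gtr0_norm// -[ltRHS]mulr1 ltr_pM2l//.
  have -> : (i%:R - j%:R : R) = (i%:Z - j%:Z)%:~R by rewrite rmorphB.
  rewrite -intr_norm -[1]/(1%:~R) ltr_int => h.
  have /eqP : i%:Z - j%:Z = 0 by lia.
  by rewrite subr_eq0 => /eqP[->].
case: u v => [u1 u2] [v1 v2] [/= h1 h2] [/= h1' h2'].
by rewrite (coord _ _ _ h1 h1') (coord _ _ _ h2 h2').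
Qed.

(** Cells are disjoint, so where two codewords differ at least one of them mismatches. Two
    candidates with at most [d] mismatches each would be within distance [2 * d]. *)
Lemma soft_decoderE k y x w : 0 < g ->
  (forall v v', v != v' -> (2 * d < hamming (code v) (code v'))%N) ->
  (#|mismatches k y w| <= d)%N -> soft_decoder k y x = w.
Proof.
move=> g0 dist wd; rewrite /soft_decoder.
case: pickP => [v vd /=|/(_ w)]; last by rewrite wd.
apply/eqP; apply: contraTT wd => /dist; rewrite -ltnNge => h.
have sub : [set s | code v s != code w s]%SET \subset
    mismatches k y v :|: mismatches k y w.
  apply/fintype.subsetP => s; rewrite !inE; apply: contraNT.
  rewrite negb_or !negbK => /andP[/asboolP h1 /asboolP h2].
  by apply/eqP; exact: cell_inj h1 h2.
have := leq_trans h (leq_trans (subset_leq_card sub) (leq_card_setU _ _)).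
move: vd; lia.
Qed.

Lemma ler_sum_inj (I J : finType) (h : I -> J) (f : J -> R) :
  injective h -> (forall j, 0 <= f j) -> \sum_i f (h i) <= \sum_j f j.
Proof.
move=> hi f0; rewrite [leRHS](bigID (mem (h @: [set: I])%SET))/=.
rewrite big_imset/=; last by move=> x y _ _; exact: hi.
rewrite [X in _ <= X + _](eq_bigl predT); last by move=> x; rewrite inE.
by rewrite lerDl sumr_ge0.
Qed.

Lemma quantize_err (x : R) : `|x| < n.+1%:R / 2 ->
  `|level (quantize x) - x| <= 1.
Proof.
move=> xn; rewrite /level /quantize.
have /andP[x1 x2] : - (n.+1%:R / 2) < x < n.+1%:R / 2 by rewrite -ltr_norml.
set y := x + n.+1%:R / 2.
have y0 : 0 <= y by rewrite /y; lra.
have yn : y < n.+1%:R by rewrite /y; lra.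
have /andP[h1 h2] := truncn_itv y0.
rewrite inordK; last first.
  by rewrite -(ltr_nat R); exact: le_lt_trans yn.
rewrite (_ : _ - _ - x = (Num.truncn y)%:R - y); last by rewrite /y; lra.
rewrite distrC ger0_norm ?subr_ge0//.
rewrite -natr1 in h2; lra.
Qed.

Lemma level_le (j : 'I_n.+1) : `|level j| <= n.+1%:R / 2.
Proof.
rewrite /level.
have h : (j%:R : R) <= n.+1%:R by rewrite ler_nat ltnW.
have h0 : 0 <= (j%:R : R) by [].
by rewrite ler_norml; apply/andP; split; lra.
Qed.

Lemma signal_power e msg a b t :
  complex.Re (signal e msg a b t) ^+ 2 + complex.Im (signal e msg a b t) ^+ 2
    <= n.+1%:R ^+ 2.
Proof.
rewrite /signal.
have [/existsP[j /eqP je]|none] := boolP [exists j, active_node b j == e].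
  rewrite (big_pred1 j); last first.
    by move=> j' /=; rewrite -je (inj_eq (@active_node_inj b)).
  have l2 (i : 'I_n.+1) : level i ^+ 2 <= (n.+1%:R / 2) ^+ 2.
    by rewrite -real_normK ?num_real// lerXn2r// ?nnegrE// ?divr_ge0// level_le.
  have := l2 (msg (j, a, t)).1; have := l2 (msg (j, a, t)).2.
  rewrite /quantized_signal /= => h1 h2; rewrite (le_trans (lerD h2 h1))//.
  have : 0 <= (n.+1%:R : R) ^+ 2 by rewrite exprn_ge0.
  by rewrite expr_div_n; lra.
rewrite big1 /=; last first.
  by move=> j je; case/existsP: none; exists j.
by rewrite expr0n addr0 exprn_ge0.
Qed.

(** Only one slot in [B.+1] can carry a signal, so averaging divides the bound on the signal power
    by [B.+1]. *)
Lemma soft_power T (P : R) H' F D e : n.+1%:R ^+ 2 <= P * B.+1%:R ->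
  codeword_power (soft_policy T) H' F D e <= P.
Proof.
move=> nP; rewrite /codeword_power /= /codeword /=.
set X := ('I_K * 'I_M * 'I_tau)%type.
have cS : #|{: slot}| = (B.+1 * #|{: X}|)%N by rewrite card_prod card_ord.
pose f (s : slot) : R := if s.1 == 0 then n.+1%:R ^+ 2 else 0.
have Sle : \sum_(t < #|{: slot}|)
    (complex.Re (soft_edge e (cached (soft_policy T) F e)
       (soft_fronthaul e F (cached (soft_policy T) F e) D) D 0 t) ^+ 2 +
     complex.Im (soft_edge e (cached (soft_policy T) F e)
       (soft_fronthaul e F (cached (soft_policy T) F e) D) D 0 t) ^+ 2)
    <= #|{: X}|%:R * n.+1%:R ^+ 2.
  apply: (@le_trans _ _ (\sum_(t < #|{: slot}|) f (enum_val t))).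
    apply: ler_sum => t _; rewrite !mxE /f; case: (enum_val t) => p [[a b] t'] /=.
    case: ifP => _; first exact: signal_power.
    by rewrite /= expr0n addr0.
  rewrite -(reindex (@enum_val slot predT) (P := predT) (F := f)) /=; last first.
    exact: onW_bij (enum_val_bij _).
  rewrite -(pair_big predT predT (fun p x => f (p, x)))/= big_ord_recl.
  rewrite [X in _ + X]big1 ?addr0; last by move=> i _; rewrite /f/= big1.
  by rewrite /f/= sumr_const mulr_natl.
apply: (le_trans (ler_wpM2l _ Sle)); first by rewrite invr_ge0.
(* An empty schedule, as in the silent delivery, has average power 0; the hypothesis still yields
   [0 <= P]. *)
have [X0|X0] := posnP #|{: X}|.
  rewrite X0 mul0r mulr0.
  have : 0 <= P * B.+1%:R by apply: le_trans nP; rewrite exprn_ge0.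
  by rewrite pmulr_lge0.
rewrite cS mulrC ler_pdivrMr ?ltr0n ?muln_gt0//.
by rewrite natrM mulrC mulrA ler_pM2r ?ltr0n.
Qed.

Definition channel_gain : R := \sum_k \sum_e l1norm (H k e).

(** Zero forcing cancels the symbols of the other users; beside the noise there remains the channel
    applied to the rounding errors, each at most 2 in [l1norm]. *)
Lemma soft_received T F D (Z : 'M[R[i]]_(K, #|{: slot}|)) k s :
  (forall a b, active_minor a b \in unitmx) ->
  (forall a b t j, l1norm (precoded F D a b t j 0) < n.+1%:R / 2) ->
  l1norm (received (p := soft_policy T) (H := H) F D Z k (user_slot k s)
      - (point (code (F (D k)) s) + Z k (user_slot k s))) <= 2 * channel_gain.
Proof.
move=> Hu small; case: s => [[i b] t].
set a := k - widen_ord mK i.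
have aik : active_user a i = k by rewrite /active_user /a subrK.
pose err j := quantized_signal (quantize (complex.Re (precoded F D a b t j 0)),
                  quantize (complex.Im (precoded F D a b t j 0)))
              - precoded F D a b t j 0.
have errP j : l1norm (err j) <= 2.
  have := small a b t j; rewrite /err /l1norm.
  case: (precoded F D a b t j 0) => x y /= xy.
  have x0 := normr_ge0 x; have y0 := normr_ge0 y.
  have h1 : `|x| < n.+1%:R / 2 by lra.
  have h2 : `|y| < n.+1%:R / 2 by lra.
  have := quantize_err h1; have := quantize_err h2; lra.
have zf : \sum_j H k (active_node b j) * precoded F D a b t j 0
    = point (code (F (D k)) (i, b, t)).
  have : (active_minor a b *m precoded F D a b t) i 0 = target F D a b t i 0.
    by rewrite /precoded mulKVmx.
  rewrite !mxE aik => <-; apply: eq_bigr => j _.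
  by rewrite !mxE aik.
rewrite (_ : _ - _ = \sum_j H k (active_node b j) * err j); last first.
  rewrite -zf /received /user_slot !mxE opprD addrACA subrr addr0.
  rewrite -sumrN.
  under eq_bigr => e _ do rewrite !mxE enum_rankK eqxx.
  rewrite /signal.
  under eq_bigr => e _ do rewrite mulr_sumr.
  (* Each position is held by exactly one node, so the sum over nodes and the positions they hold is
     a sum over positions. *)
  rewrite (exchange_big_dep predT)//= -big_split/=; apply: eq_bigr => j _.
  rewrite (big_pred1 (active_node b j)); last by move=> e; rewrite eq_sym.
  by rewrite /soft_fronthaul ffunE /active_node addrK -mulrBr.
apply: (le_trans (l1norm_sum _ _ _)).
rewrite /channel_gain mulr_sumr (bigD1 k)//=.
apply: (@le_trans _ _ (2 * \sum_e l1norm (H k e))); last first.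
  rewrite lerDl sumr_ge0// => k' _; rewrite mulr_ge0// sumr_ge0// => e _.
  exact: l1norm_ge0.
apply: (@le_trans _ _ (\sum_j 2 * l1norm (H k (active_node b j)))).
  apply: ler_sum => j _; apply: (le_trans (l1normM _ _)).
  by rewrite mulrC ler_wpM2r// l1norm_ge0.
rewrite -mulr_sumr ler_pM2l//.
by apply: (ler_sum_inj (@active_node_inj b) (f := fun e => l1norm (H k e))) => e;
  exact: l1norm_ge0.
Qed.

Lemma measurable_soft_error T F D k :
  measurable [set z | decoded (p := soft_policy T) (H := H) F D (mx_of_tuple z) k
                      <> F (D k)].
Proof.
pose y (z : (K * #|{: slot}|).-tuple R[i]) : #|{: slot}|.-tuple R[i] :=
  [tuple received (p := soft_policy T) (H := H) F D (mx_of_tuple z) k t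
     | t < #|{: slot}|].
have my : measurable_fun setT y.
  apply/measurable_fun_tnthP => t; apply: cmeasurable_measurable.
  rewrite (_ : _ \o y = fun z => (H *m \matrix_(e < M) codeword (soft_policy T)
      H F D e) k t + tnth z (mxvec_index k t)); last first.
    by apply/funext => z; rewrite /= tnth_mktuple /received !mxE.
  apply: cmeasurableD; first exact: cmeasurable_cst.
  exact: cmeasurable_tnth.
have := my measurableT _ (measurableC (@measurable_soft_decoder k (D k) (F (D k)))).
by rewrite setTI.
Qed.

(** Rounding costs at most [2 * channel_gain], so a sample leaves its cell only if its noise leaves
    the box of radius [rho]. An error thus needs [d.+1] bad noise samples among [m * M * tau], and
    [iid_many_bad] applies for each library. *)
Lemma soft_user_error T D k (rho c : R) :
  0 < g -> rho + 2 * channel_gain <= g / 2 ->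
  (complex_normal R (~` box 0 0 rho) <= c%:E)%E -> c <= 1 ->
  (forall v v', v != v' -> (2 * d < hamming (code v) (code v'))%N) ->
  (forall a b, active_minor a b \in unitmx) ->
  (forall F a b t j, l1norm (precoded F D a b t j 0) < n.+1%:R / 2) ->
  user_error (soft_policy T) H D k <= 2 ^+ (m * M * tau) * c ^+ d.+1.
Proof.
move=> g0 rhog noise c1 dist Hu small.
have c0 : 0 <= c by rewrite -lee_fin (le_trans _ noise).
have lib0 : (0 < #|library N L|)%N.
  by rewrite card_ffun card_ord expn_gt0 expn_gt0.
set bound := _ * _.
rewrite /user_error.
have err F : fine (iid (complex_normal R) (K * #|{: slot}|)
    [set z | decoded (p := soft_policy T) (H := H) F D (mx_of_tuple z) k
             <> F (D k)]) <= bound.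
  rewrite -lee_fin fineK; last first.
    by apply: fin_num_measure; exact: measurable_soft_error.
  (* The noise coordinate that disturbs symbol [s] of user [k]; as [pos] is injective, distinct
     mismatches give distinct bad samples. *)
  pose pos (s : 'I_m * 'I_M * 'I_tau) := mxvec_index k (user_slot k s).
  have pos_inj : injective pos.
    move=> s s'; rewrite /pos /mxvec_index => /cast_ord_inj/enum_rank_inj[].
    exact: user_slot_inj.
  pose J := (pos @: [set: _])%SET.
  have cJ : #|J| = (m * M * tau)%N.
    by rewrite card_imset// cardsT !card_prod !card_ord.
  rewrite /bound -cJ; apply: (@iid_many_bad _ _ _ _ _ _ (~` box 0 0 rho)) => //.
  - by apply: measurableC; exact: measurable_box.
  - exact: measurable_soft_error.
  move=> z Ez.
  pose y := [tuple received (p := soft_policy T) (H := H) F D (mx_of_tuple z) k t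
     | t < #|{: slot}|].
  have many : (d < #|mismatches k y (F (D k))|)%N.
    rewrite ltnNge; apply/negP => few; apply: Ez.
    exact: soft_decoderE few.
  exists (pos @: mismatches k y (F (D k)))%SET; split.
  - by apply: imsetS; apply/fintype.subsetP => s; rewrite inE.
  - by rewrite card_imset.
  move=> i /imsetP[s]; rewrite inE => /asboolP far -> near0; apply: far.
  have := soft_received T (mx_of_tuple z) k s Hu (small F).
  rewrite tnth_mktuple; set r := received _ _ _ _ _.
  have -> : mx_of_tuple z k (user_slot k s) = tnth z (pos s) by rewrite mxE.
  move: near0 => []; rewrite !subr0; move: (tnth z (pos s)) => -[w1 w2] /=.
  rewrite /cell /point; move: (code _ _) => u.
  case: r => r1 r2 h1 h2; rewrite /l1norm /= => h3.
  have h5 := normr_ge0 (r1 - (g * u.1%:R + w1)).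
  have h6 := normr_ge0 (r2 - (g * u.2%:R + w2)).
  split => /=.
    rewrite (_ : _ - _ = (r1 - (g * u.1%:R + w1)) + w1); last by ring.
    by apply: (le_lt_trans (ler_normD _ _)); lra.
  rewrite (_ : _ - _ = (r2 - (g * u.2%:R + w2)) + w2); last by ring.
  by apply: (le_lt_trans (ler_normD _ _)); lra.
apply: (@le_trans _ _ (\sum_(F : library N L) #|library N L|%:R^-1 * bound)).
  by apply: ler_sum => F _; rewrite ler_wpM2l ?invr_ge0//; exact: err.
rewrite sumr_const -[leLHS]mulr_natl mulrA divff ?mul1r//.
by rewrite pnatr_eq0 -lt0n.
Qed.

Lemma soft_error_probability T (rho c : R) :
  0 < g -> rho + 2 * channel_gain <= g / 2 ->
  (complex_normal R (~` box 0 0 rho) <= c%:E)%E -> c <= 1 ->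
  (forall v v', v != v' -> (2 * d < hamming (code v) (code v'))%N) ->
  (forall a b, active_minor a b \in unitmx) ->
  (forall F D a b t j, l1norm (precoded F D a b t j 0) < n.+1%:R / 2) ->
  error_probability (soft_policy T) H <= 2 ^+ (m * M * tau) * c ^+ d.+1.
Proof.
move=> g0 rhog noise c1 dist Hu small.
have c0 : 0 <= c by rewrite -lee_fin (le_trans _ noise).
have b0 : 0 <= 2 ^+ (m * M * tau) * c ^+ d.+1 :> R.
  by rewrite mulr_ge0// exprn_ge0.
rewrite /error_probability.
elim/big_ind : _ => // [x y x0 y0|D _]; first by rewrite ge_max x0.
elim/big_ind : _ => // [x y x0 y0|k _]; first by rewrite ge_max x0.
by apply: (@soft_user_error T D k _ _ g0 rhog noise) => // F a b t j; exact: small.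
Qed.

(** A constant cache has entropy 0, and each of the [m * K * tau] symbols of a message takes
    [n.+1 * n.+1] values. *)
Lemma soft_decoder_admissible T (CF P : R) (mu : R) : 0 <= mu ->
  n.+1%:R ^+ 2 <= P * B.+1%:R ->
  (((n.+1 * n.+1) ^ (m * K * tau))%N%:R <= 2 `^ (T%:R * CF))%R ->
  admissible (soft_policy T) mu CF P.
Proof.
move=> mu0 nP cap; split=> [e x|H'].
  rewrite /entropy (big_pred1 tt); last by case.
  rewrite (_ : [set w | _]%SET = [set: _]%SET); last first.
    by apply/setP => w; rewrite !inE; case: (cache _ _ _ _).
  rewrite cardsT divff; last by rewrite pnatr_eq0 card_ord -lt0n expn_gt0.
  by rewrite /log2 ln1 mul0r mulr0 oppr0 mulr_ge0.
split=> [|F D e|k x w].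
- by rewrite /= card_ffun !card_prod !card_ord.
- exact: soft_power.
- exact: measurable_soft_decoder.
Qed.

(** A crude bound on all inverse entries at once; it depends on the channel but not on the power. *)
Definition inverse_gain : R :=
  \sum_a \sum_b \sum_j \sum_i l1norm (invmx (active_minor a b) j i).

Lemma precoded_le F D a b t j : 0 <= g ->
  l1norm (precoded F D a b t j 0) <= inverse_gain * (2 * (g * q%:R)).
Proof.
move=> g0.
have pointP u : l1norm (point u) <= 2 * (g * q%:R).
  have coord (i : 'I_q) : `|g * i%:R| <= g * q%:R.
    by rewrite ger0_norm ?mulr_ge0// ler_wpM2l// ler_nat ltnW.
  by rewrite /l1norm /=; have := coord u.1; have := coord u.2; lra.
rewrite /precoded mxE; apply: (le_trans (l1norm_sum _ _ _)).
have sum1 (I : finType) (f : I -> R) i : (forall j, 0 <= f j) -> f i <= \sum_i f i.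
  by move=> f0; rewrite (bigD1 i)//= lerDl sumr_ge0.
apply: (@le_trans _ _ ((\sum_i l1norm (invmx (active_minor a b) j i)) * (2 * (g * q%:R)))).
  rewrite mulr_suml; apply: ler_sum => i _; apply: (le_trans (l1normM _ _)).
  by rewrite ler_wpM2l ?l1norm_ge0// mxE.
rewrite ler_wpM2r ?mulr_ge0// /inverse_gain.
have n1s a' b' j' : 0 <= \sum_i l1norm (invmx (active_minor a' b') j' i).
  by rewrite sumr_ge0// => i _; exact: l1norm_ge0.
have n1s2 a' b' : 0 <= \sum_j' \sum_i l1norm (invmx (active_minor a' b') j' i).
  by rewrite sumr_ge0.
have n1s3 a' : 0 <= \sum_b' \sum_j' \sum_i l1norm (invmx (active_minor a' b') j' i).
  by rewrite sumr_ge0.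
apply: le_trans (sum1 _ _ a n1s3).
apply: le_trans (sum1 _ _ b (n1s2 a)).
exact: (sum1 _ _ j (n1s a b)).
Qed.

End scheme.

Definition constant_policy (R : realType) (M K N L : nat)
    (p : @delivery R M K N L unit) : @policy R M K N L :=
  @Policy R M K N L unit (fun _ _ _ => tt) (fun _ => p).

(** * Constellation, code rate and durations *)

Section parameters.
Context {R : realType}.
Local Notation lg := (@log2 R).

Lemma log2_gt0 (x : R) : 1 < x -> 0 < lg x.
Proof. by move=> x1; rewrite /log2 divr_gt0// ln_gt0// ltr1n. Qed.

Lemma powR2_log2 (x : R) : 0 < x -> 2 `^ (lg x) = x.
Proof.
move=> x0; rewrite /powR pnatr_eq0/= /log2 divfK ?lnK//.
by rewrite gt_eqF// ln_gt0// ltr1n.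
Qed.

(* [Q] is the alphabet size, [2 d] the distance, [T] the blocklength and [lP]
   stands for [ln P]. *)
Lemma code_rate (v L T d Q : nat) (lP : R) :
  (4 < v)%N -> (0 < Q)%N -> (v * d <= T)%N ->
  (v.-1)%:R * lP <= v%:R * ln Q%:R ->
  v%:R * ln 2 <= lP ->
  v%:R * (L%:R * ln 2) <= (v - 4)%:R * (T%:R * lP) ->
  (2 ^ L * (2 ^ T * Q ^ (2 * d)) <= Q ^ T)%N.
Proof.
move=> v4 Q0 vd Qrate Prate Lrate.
have ln2 : 0 < ln 2 :> R by rewrite ln_gt0// ltr1n.
have v0 : 0 < v%:R :> R by rewrite ltr0n; lia.
have Q0' : 0 < Q%:R :> R by rewrite ltr0n.
rewrite -(ler_nat R) !natrM !natrX.
rewrite -ler_ln ?posrE ?mulr_gt0 ?exprn_gt0//.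
rewrite !lnM ?posrE ?mulr_gt0 ?exprn_gt0//.
rewrite !lnXn ?ltr0n; [|by []..].
rewrite -[ln 2 *+ L]mulr_natl -[ln 2 *+ T]mulr_natl -[_ *+ (2 * d)]mulr_natl -[leRHS]mulr_natl.
set q := ln Q%:R in Qrate *.
have dT : v%:R * d%:R <= T%:R :> R by rewrite -natrM ler_nat.
move: Qrate Lrate; rewrite natrB; last by lia.
have -> : v.-1%:R = v%:R - 1 :> R by rewrite -subn1 natrB//; lia.
have vv : 5 <= v%:R :> R by rewrite ler_nat.
have T0 : 0 <= T%:R :> R by [].
have d0 : 0 <= d%:R :> R by [].
have L0 : 0 <= L%:R :> R by [].
rewrite natrM.
move: (v%:R) (T%:R) (d%:R) (L%:R) (ln 2) dT vv T0 d0 L0 ln2 v0 Prate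
  => V t D l e dT vv T0 d0 L0 e0 V0 Prate Qrate Lrate.
have P0 : 0 < lP by apply: lt_le_trans Prate; rewrite mulr_gt0.
have q0 : 0 <= q.
  rewrite -(pmulr_rge0 _ V0); apply: le_trans Qrate.
  by rewrite mulr_ge0//; lra.
(* After scaling by [V * V], the distance leaves at least [(V - 2) * (V - 1)] times [t * lP], while
   the file size and the factor [2 ^ T] take at most [V * (V - 4) + V] times it, which is smaller by
   2. *)
rewrite -(ler_pM2l V0) -(ler_pM2l V0).
have h1 : V * (V * (2 * D * q)) <= V * (2 * t * q).
  rewrite ler_pM2l// (_ : V * _ = 2 * (V * D) * q); last by ring.
  by rewrite ler_wpM2r//; lra.
have h2 : (V - 2) * t * ((V - 1) * lP) <= (V - 2) * t * (V * q).
  by rewrite ler_wpM2l// mulr_ge0//; lra.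
have h3 : V * (V * (l * e)) <= V * ((V - 4) * (t * lP)) by rewrite ler_pM2l.
have h4 : V * (t * (V * e)) <= V * (t * lP).
  by rewrite ler_pM2l// ler_wpM2l.
have h5 : 0 <= t * lP by rewrite mulr_ge0// ltW.
lra.
Qed.

(** With [n.+1] near [Num.sqrt P] and [q] near [n.+1 / (8 C s)], the grid has at least [P / W ^+ 2]
    points for [W = 32 * C * s]. The bound on [P] gives [2 v ln W <= ln P], so the loss [2 ln W] is
    at most [ln P / v]. *)
Lemma constellation_size (v : nat) (C s P : R) :
  (0 < v)%N -> 1 <= C -> 1 <= s -> (32 * C * s) ^+ (2 * v) <= P ->
  exists n q : nat, [/\ (n.+1%:R ^+ 2 <= P)%R, (0 < q)%N,
    C * (2 * (s * q%:R)) < n.+1%:R / 2,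
    (v.-1)%:R * ln P <= v%:R * ln (q * q)%N%:R & v%:R * ln 2 <= ln P].
Proof.
move=> v0 C1 s1 WP; set W := 32 * C * s in WP.
have Cs1 : 1 <= C * s by rewrite -[1]mulr1 ler_pM.
have W32 : 32 <= W by rewrite /W -mulrA; lra.
have W1 : 1 <= W by lra.
have W0 : 0 < W by lra.
have W2P : W ^+ 2 <= P.
  by apply: le_trans WP; rewrite ler_weXn2l//; lia.
have P1 : 1 <= P by apply: le_trans W2P; rewrite exprn_ege1.
have P0 : 0 < P by lra.
have WS : W <= Num.sqrt P.
  rewrite -(@ler_pXn2r _ 2)// ?nnegrE ?sqrtr_ge0//; last by lra.
  by rewrite sqr_sqrtr//; lra.
set S := Num.sqrt P in WS.
have S0 : 0 <= S by rewrite sqrtr_ge0.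
have SS : S ^+ 2 = P by rewrite sqr_sqrtr// ltW.
have /andP[t1 t2] := truncn_itv S0.
pose n := (Num.truncn S).-1.
have nE : n.+1 = Num.truncn S.
  rewrite /n prednK// -(ltr0n R).
  by move: t2; rewrite -natr1; lra.
rewrite -nE in t1 t2; rewrite -natr1 in t2.
set N := n.+1%:R : R in t1 t2.
have N1 : 1 <= N by rewrite /N ler1n.
(* The factor 8 keeps [C * (2 * (s * q))] at most [N / 4], safely below [N / 2]. *)
pose x : R := N / (8 * (C * s)).
have x0 : 0 <= x by rewrite divr_ge0//; lra.
have xE : x * (8 * (C * s)) = N by rewrite /x divfK//; lra.
have /andP[q1 q2] := truncn_itv x0.
set q := Num.truncn x in q1 q2; rewrite -natr1 in q2.
have x2 : 2 <= x.
  rewrite /x ler_pdivlMr; last by lra.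
  have : 32 * (C * s) <= S by rewrite mulrA.
  by move=> h; lra.
(* Rounding [S] to [N] and [x] to [q] loses at most a factor 2 each; with the factor 8 this makes
   the 32 of [W]. *)
have qW : S <= q%:R * W.
  have h1 : x <= 2 * q%:R by lra.
  have h2 : N <= 2 * q%:R * (8 * (C * s)).
    by rewrite -xE ler_wpM2r//; lra.
  rewrite /W; lra.
have q0 : (0 < q)%N by rewrite -(ltr0n R); lra.
have lnW : (2 * v)%:R * ln W <= ln P.
  by rewrite mulr_natl -lnXn// ler_ln ?posrE// exprn_gt0.
exists n, q; split => //.
- by rewrite -SS lerXn2r ?nnegrE// (le_trans _ t1).
- have : q%:R * (8 * (C * s)) <= N by rewrite -xE ler_wpM2r//; lra.
  by rewrite -/N; lra.
- have PqW : ln P <= ln (q * q)%N%:R + 2 * ln W.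
    rewrite -SS mulr_natl -lnXn// -lnM ?posrE ?exprn_gt0//; last first.
      by rewrite ltr0n muln_gt0 q0.
    have Sp : 0 < S by lra.
    have qp : 0 < (q * q)%N%:R * W ^+ 2 by rewrite mulr_gt0 ?exprn_gt0// ltr0n muln_gt0 q0.
    rewrite ler_ln ?posrE// ?exprn_gt0//.
    rewrite natrM -expr2 -exprMn lerXn2r ?nnegrE//.
    by rewrite mulr_ge0//; lra.
  have vv : v.-1%:R = v%:R - 1 :> R by rewrite -subn1 natrB.
  have : v%:R * ln P <= v%:R * (ln (q * q)%N%:R + 2 * ln W) by rewrite ler_wpM2l.
  move: lnW; rewrite vv natrM mulrDr; lra.
- apply: le_trans lnW; rewrite natrM.
  have : ln 2 <= ln W by rewrite ler_ln ?posrE//; lra.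
  have : 0 <= ln 2 :> R by rewrite ln_ge0// ler1n.
  have vR : 0 <= v%:R :> R by [].
  move=> h1 h2; have := ler_wpM2l vR h2; have := mulr_ge0 vR h1; lra.
Qed.

Lemma sum_l1norm_ge0 (I J : finType) (f : I -> J -> R[i]) :
  0 <= \sum_i \sum_j l1norm (f i j).
Proof. by apply: sumr_ge0 => i _; apply: sumr_ge0 => j _; exact: l1norm_ge0. Qed.

(** The code is designed for power [P'] and sent at power [P] with padding factor [B.+1]. The
    threshold [P0] comes before [r], [P] and [L], so it stays fixed in both limits. *)
Lemma soft_transfer_delivery (K' M' N m v : nat) (mK : (m <= K'.+1)%N)
    (mM : (m <= M'.+1)%N) (H : 'M[R[i]]_(K'.+1, M'.+1)) :
  (0 < m)%N -> (4 < v)%N ->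
  (forall a b, active_minor mK mM H a b \in unitmx) ->
  exists2 P0 : R, 1 < P0 & forall (r P P' mu : R) (B L : nat),
    0 < r -> 1 < P -> P0 <= P' -> P' <= P * B.+1%:R -> 0 <= mu ->
    let tau := (Num.truncn (v%:R / (v - 4)%:R * L%:R /
                             ((m * M'.+1)%N%:R * lg P'))).+1 in
    let T := (Num.truncn ((m * K'.+1 * tau)%N%:R * lg P' / (r * lg P))).+1 in
    exists p : @delivery R M'.+1 K'.+1 N L unit,
      [/\ fronthaul_time p = T,
          edge_time p = (B.+1 * (K'.+1 * M'.+1 * tau))%N,
          admissible (constant_policy p) mu (r * lg P) P
        & error_probability (constant_policy p) H <= (1 / 2) ^+ (m * M'.+1 * tau)].
Proof.
move=> m0 v4 Hu.
(* Small enough for the union bound: with [A] symbols and [A <= v * d.+1], the factor [2 ^+ A] meets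
   [c ^+ d.+1 <= (1 / 4) ^+ A]. *)
pose c : R := (1 / 4) ^+ v.
have c0 : 0 < c by rewrite exprn_gt0 //; lra.
have c1 : c <= 1 by rewrite exprn_ile1 //; lra.
have [rho rho0 noise] := box_tight (complex_normal R) c0.
have G0 : 0 <= channel_gain H by exact: sum_l1norm_ge0.
have I0 : 0 <= inverse_gain mK mM H.
  by apply: sumr_ge0 => a _; apply: sumr_ge0 => b _; exact: sum_l1norm_ge0.
(* The grid spacing: half of it covers noise and rounding, and the summand 1 ensures [1 <= s]. *)
pose s := 2 * (rho + 2 * channel_gain H) + 1.
have s1 : 1 <= s by rewrite /s; lra.
have rhos : rho + 2 * channel_gain H <= s / 2 by rewrite /s; lra.
pose C := inverse_gain mK mM H + 1.
have C1 : 1 <= C by rewrite /C; lra.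
have Cs1 : 1 <= C * s by rewrite -[1]mulr1 ler_pM.
have W1 : 1 < (32 * C * s) ^+ (2 * v).
  have W1 : 1 < 32 * C * s by rewrite -mulrA; lra.
  by rewrite (exprn_egt1 _ W1) muln_eq0 negb_or/= -lt0n (ltn_trans _ v4).
exists ((32 * C * s) ^+ (2 * v)) => //.
have v0 : (0 < v)%N by exact: ltn_trans v4.
move=> r P P' mu B L r0 P1 PP' P'B mu0 tau T.
have [n [q [nP q0 small rate1 rate2]]] := constellation_size v0 C1 s1 PP'.
have P'1 : 1 < P'.
  exact: lt_le_trans PP'.
have lP := log2_gt0 P1; have lP' := log2_gt0 P'1.
have ln2 : 0 < ln 2 :> R by rewrite ln_gt0// ltr1n.
set A := (m * M'.+1 * tau)%N.
have tauP : v%:R / (v - 4)%:R * L%:R / ((m * M'.+1)%N%:R * lg P') <= tau%:R.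
  by rewrite ltW// truncnS_gt.
have mM0 : 0 < (m * M'.+1)%N%:R :> R by rewrite ltr0n muln_gt0 m0.
have v40 : 0 < (v - 4)%N%:R :> R by rewrite ltr0n subn_gt0.
have lrate : v%:R * (L%:R * ln 2) <= (v - 4)%:R * (A%:R * ln P').
  move: tauP; rewrite ler_pdivrMr; last exact: mulr_gt0 mM0 lP'.
  move=> tauP.
  have {}tauP : v%:R * L%:R <= (v - 4)%:R * (A%:R * lg P').
    rewrite -ler_pdivrMl// mulrA [_^-1 * _]mulrC; apply: (le_trans tauP).
    by rewrite /A [in leRHS]natrM; lra.
  have -> : ln P' = lg P' * ln 2 by rewrite /log2 divfK// gt_eqF.
  by rewrite !mulrA ler_pM2r// -!mulrA.
(* Rounding down gives [v * d <= A] for the rate, yet [A < v * d.+1] for the error. *)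
pose d := (A %/ v)%N.
have q20 : (0 < q * q)%N by rewrite muln_gt0 q0.
have vd : (v * d <= A)%N by rewrite mulnC leq_divM.
have rate := code_rate v4 q20 vd rate1 rate2 lrate.
have cA : A = #|{: 'I_m * 'I_M'.+1 * 'I_tau}| by rewrite !card_prod !card_ord.
have cQ : (q * q)%N = #|{: 'I_q * 'I_q}| by rewrite card_prod !card_ord.
rewrite cA cQ in rate.
have Q0 : (0 < #|{: 'I_q * 'I_q}|)%N by rewrite -cQ.
have [code codeP] := gilbert_varshamov Q0 rate.
have s0 : 0 < s by apply: lt_le_trans s1.
have small' (F : library N L) D a b t j :
    l1norm (precoded s mK mM code H F D a b t j 0) < n.+1%:R / 2.
  apply: le_lt_trans small; apply: le_trans (precoded_le _ _ _ _ _ _ _ _ _ _ (ltW s0)) _.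
  by rewrite /C ler_wpM2r// ?mulr_ge0// ?(ltW s0)// lerDl.
exists (soft_delivery N B n d s mK mM code H T).
split => //=.
- by rewrite !card_prod !card_ord.
- apply: soft_decoder_admissible => //; first exact: le_trans P'B.
  rewrite natrX natrM -expr2.
  apply: (@le_trans _ _ (P' ^+ (m * K'.+1 * tau))).
    by rewrite lerXn2r ?nnegrE ?exprn_ge0//; lra.
  rewrite -{1}(powR2_log2 (lt_trans ltr01 P'1)) -powR_mulrn ?powR_ge0// -powRrM.
  rewrite ler_powR ?ler1n//.
  have : (m * K'.+1 * tau)%N%:R * lg P' / (r * lg P) <= T%:R.
    by rewrite ltW// truncnS_gt.
  by rewrite ler_pdivrMr ?[lg P' * _]mulrC//; exact: mulr_gt0 r0 lP.
- apply: (@le_trans _ _ (2 ^+ A * c ^+ d.+1)).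
    by apply: (@soft_error_probability R K' M' N m L tau B q n d s mK mM code H
         T rho c s0 rhos noise c1 codeP Hu small').
  rewrite /c -exprM.
  apply: (@le_trans _ _ (2 ^+ A * (1 / 4) ^+ A)).
    rewrite ler_wpM2l ?exprn_ge0// ler_wiXn2l//; first by lra.
    by rewrite mulnC ltnW// ltn_ceil//; lia.
  by rewrite -exprMn (_ : 2 * _ = 1 / 2 :> R)//; lra.
Qed.

End parameters.

(** * Delivery times *)

Section limits.
Context {R : realType}.

Lemma limn_esup_ratio (f : nat -> nat) (l c : R) :
  (forall L, `|(f L)%:R - l * L%:R| <= c) ->
  limn_esup (fun L => ((f L)%:R / L%:R)%:E) = l%:E.
Proof.
move=> fc.
have cf : (f L)%:R / L%:R @[L --> \oo] --> l.
  apply/cvgrPdist_le => e e0; near=> L.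
  have L0 : 0 < L%:R :> R by near: L; exact: nbhs_infty_gtr.
  have -> : l - (f L)%:R / L%:R = - ((f L)%:R - l * L%:R) / L%:R.
    by rewrite opprB mulrBl mulfK// gt_eqF.
  rewrite normrM normrN normfV (gtr0_norm L0) ler_pdivrMr//.
  apply: (le_trans (fc L)); rewrite -ler_pdivrMl// ltW//.
  by near: L; exact: nbhs_infty_gtr.
have cfE : ((f L)%:R / L%:R)%:E @[L --> \oo] --> l%:E.
  by apply/fine_cvgP; split; [exact: nearW|exact: cf].
rewrite is_cvg_limn_esupE; last by apply/cvg_ex; exists l%:E.
exact/cvg_lim.
Unshelve. all: by end_near.
Qed.

Lemma cvg_half_expr (f : nat -> nat) (x : R) : 0 < x ->
  (forall L, x * L%:R <= (f L)%:R) -> (1 / 2 : R) ^+ f L @[L --> \oo] --> (0 : R).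
Proof.
move=> x0 xf.
have : f @ \oo --> \oo.
  apply/cvgnyPge => A; near=> L.
  rewrite -(ler_nat R) (le_trans _ (xf L))// -ler_pdivrMl// ltW//.
  by near: L; exact: nbhs_infty_gtr.
move=> finf; apply: (cvg_comp _ _ finf).
by apply: cvg_expr; rewrite ger0_norm; lra.
Unshelve. all: by end_near.
Qed.

Lemma truncnS_dist (y : R) : 0 <= y -> `|(Num.truncn y).+1%:R - y| <= 1.
Proof.
move=> /truncn_itv/andP[h1 h2].
rewrite ger0_norm ?subr_ge0 ?(ltW h2)//.
by rewrite -natr1; lra.
Qed.

(* [tau] blocks of the schedule last [K M tau] channel uses, and their
   fronthaul messages take [m K tau / r]. *)
Lemma delivery_time_dist (m K M L tau T : nat) (x r : R) : 0 <= x -> 0 < r ->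
  tau = (Num.truncn (x * L%:R)).+1 ->
  T = (Num.truncn ((m * K * tau)%N%:R / r)).+1 ->
  `|(T + K * M * tau)%N%:R - ((m * K)%N%:R / r + (K * M)%N%:R) * x * L%:R|
    <= 1 + ((m * K)%N%:R / r + (K * M)%N%:R).
Proof.
move=> x0 r0 tauE TE.
have htau : `|tau%:R - x * L%:R| <= 1 by rewrite tauE truncnS_dist// mulr_ge0.
have hT : `|T%:R - (m * K * tau)%N%:R / r| <= 1.
  by rewrite TE truncnS_dist// divr_ge0// ltW.
have b0 : 0 <= (m * K)%N%:R / r + (K * M)%N%:R.
  by rewrite addr_ge0// divr_ge0// ltW.
rewrite (_ : _ - _ = (T%:R - (m * K * tau)%N%:R / r) +
   ((m * K)%N%:R / r + (K * M)%N%:R) * (tau%:R - x * L%:R)); last first.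
  by rewrite natrD [(m * K * tau)%N%:R]natrM [(K * M * tau)%N%:R]natrM; ring.
apply: (le_trans (ler_normD _ _)); rewrite lerD// normrM ger0_norm//.
by rewrite -[leRHS]mulr1 ler_wpM2l.
Qed.

(** Division by [m * M] turns the fronthaul term [m * K / r] into [K / (M * r)] and the edge term
    [K * M] into [K / m]. *)
Lemma normalized_delivery_time (M K v : nat) (r l : R) :
  (0 < M)%N -> (0 < K)%N -> (4 < v)%N -> 0 < r -> 0 < l ->
  let m := minn M K in
  ((m * K)%N%:R / r + (K * M)%N%:R) * (v%:R / (v - 4)%:R / ((m * M)%N%:R * l)) * l
    = v%:R / (v - 4)%:R * (K%:R / m%:R + K%:R / (M%:R * r)).
Proof.
move=> M0 K0 v4 r0 l0 m.
have m0 : (0 < m)%N by rewrite leq_min M0.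
have : (v - 4)%:R != 0 :> R by rewrite pnatr_eq0 -lt0n subn_gt0.
have : m%:R != 0 :> R by rewrite pnatr_eq0 -lt0n.
have : M%:R != 0 :> R by rewrite pnatr_eq0 -lt0n.
have : r != 0 by rewrite gt_eqF.
have : l != 0 by rewrite gt_eqF.
rewrite !natrM; move: (v - 4)%:R m%:R => V mm l1 r1 M1 m1 V1.
by field; rewrite r1 M1 m1 V1.
Qed.

(** The factor is [1 + 4 / (v - 4)], so the excess [4 * b / (v - 4)] drops below any [e] once
    [v - 4] exceeds [4 * b / e]. *)
Lemma le_excess_factor (x : \bar R) (b : R) : 0 <= b ->
  (forall v : nat, (4 < v)%N -> (x <= (v%:R / (v - 4)%:R * b)%:E)%E) ->
  (x <= b%:E)%E.
Proof.
move=> b0 xv; apply/lee_addgt0Pr => e e0.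
set k := Num.truncn (4 * b / e).
have hk : 4 * b / e < k.+1%:R by exact: truncnS_gt.
apply: (le_trans (xv (k.+1 + 4)%N _)); first by rewrite -[4%N]add0n ltn_add2r.
rewrite addnK -EFinD lee_fin natrD mulrDl divff ?pnatr_eq0// mulrDl mul1r lerD2l.
rewrite mulrAC ler_pdivrMr ?ltr0n// -ler_pdivrMl//.
by rewrite mulrC ltW.
Qed.

End limits.

(** * From one channel to policies for all channels *)

Section achievability.
Context {R : realType}.
Variables (K' M' N : nat) (nu : probability R[i] R) (mu r : R).
Hypotheses (nu0 : forall z : R[i], nu [set z] = 0%E) (mu0 : 0 <= mu)
  (r0 : 0 < r).

Local Notation K := K'.+1.
Local Notation M := M'.+1.
Let m := minn M K.
Let mK : (m <= K)%N := geq_minr M K.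
Let mM : (m <= M)%N := geq_minl M K.
Let m0 : (0 < m)%N. Proof. by rewrite leq_min. Qed.

Definition generic (H : 'M[R[i]]_(K, M)) : Prop :=
  forall a b, active_minor mK mM H a b \in unitmx.

Lemma ae_generic : {ae iid nu (K * M), forall h, generic (mx_of_tuple h)}.
Proof.
have h ab : {ae iid nu (K * M), forall h,
    \det (active_minor mK mM (mx_of_tuple h) ab.1 ab.2) != 0}.
  by apply: ae_minor_neq0 => //;
    [exact: active_user_inj|exact: active_node_inj].
have hh := filter_forall (ae_filter_ringOfSetsType _) h.
apply: filterS hh => z hz a b.
by rewrite unitmxE unitfE; exact: (hz (a, b)).
Qed.

(** The empty schedule [tau = 0]: a filler for exceptional channels and for [P <= 1], where no error
    bound is asked. *)
Lemma silent_delivery L (P CF : R) : 1 < P ->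
  exists p : @delivery R M K N L unit, admissible (constant_policy p) mu CF P.
Proof.
move=> P1.
pose code (_ : 'I_(2 ^ L)) : {ffun 'I_m * 'I_M * 'I_0 -> 'I_1 * 'I_1} :=
  [ffun=> (ord0, ord0)].
exists (soft_delivery N 0 0 0 1 mK mM code 0 0).
apply: soft_decoder_admissible => //; first by rewrite expr1n mulr1 ltW.
by rewrite muln0 expn0 mul0r powRr0.
Qed.

Local Notation ndt_factor v :=
  (v%:R / (v - 4)%:R * (K%:R / m%:R + K%:R / (M%:R * r))).

(* Below the threshold power [P0], which depends on the channel, the code for
   power [P0] is used and the schedule is padded with silence. *)
Lemma channel_deliveries (v : nat) (H : 'M[R[i]]_(K, M)) : (4 < v)%N ->
  exists q : R -> forall L, @delivery R M K N L unit,
    (forall P L, 1 < P ->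
       admissible (constant_policy (q P L)) mu (r * log2 P) P) /\
    (generic H ->
       (forall P, 1 < P ->
          error_probability (constant_policy (q P L)) H @[L --> \oo] --> (0 : R)) /\
       \forall P \near +oo,
         (limn_esup (fun L => ((fronthaul_time (q P L) + edge_time (q P L))%:R
            / L%:R)%:E) * (log2 P)%:E = (ndt_factor v)%:E)%E).
Proof.
move=> v4; have [gH|ngH] := pselect (generic H); last first.
  have ex P L : exists p : @delivery R M K N L unit, 1 < P ->
      admissible (constant_policy p) mu (r * log2 P) P.
    have [P1|P1] := boolP (1 < P).
      by have [p pP] := silent_delivery L (r * log2 P) P1; exists p.
    have [p _] := @silent_delivery L 2 0 ltac:(by rewrite ltr1n).
    by exists p.
  by exists (fun P L => sval (cid (ex P L))); split=> // P L; case: cid.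
have [P0 P01 scheme] := soft_transfer_delivery N m0 v4 gH.
pose P' P := Num.max P P0.
(* Below [P0] the padding ensures [P0 <= P * (B P).+1]; from [P0] on there is none. *)
pose B P := if P0 <= P then 0%N else Num.truncn (P0 / P).
pose x P : R := v%:R / (v - 4)%:R / ((m * M)%N%:R * log2 (P' P)).
pose tau P L := (Num.truncn (x P * L%:R)).+1.
pose T P L := (Num.truncn ((m * K * tau P L)%N%:R * log2 (P' P) / (r * log2 P))).+1.
have ex P L : exists p : @delivery R M K N L unit, 1 < P ->
    [/\ fronthaul_time p = T P L,
        edge_time p = ((B P).+1 * (K * M * tau P L))%N,
        admissible (constant_policy p) mu (r * log2 P) P
      & error_probability (constant_policy p) H <= (1 / 2) ^+ (m * M * tau P L)].
  have [P1|P1] := boolP (1 < P); last first.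
    have [p _] := @silent_delivery L 2 0 ltac:(by rewrite ltr1n).
    by exists p.
  have P'0 : P0 <= P' P by rewrite le_max lexx orbT.
  have P'B : P' P <= P * (B P).+1%:R.
    rewrite /P' /B; have [P0P|PP0] := boolP (P0 <= P).
      by rewrite max_l// mulr1.
    move: PP0; rewrite -ltNge => PP0.
    rewrite max_r ?(ltW PP0)// -ler_pdivrMl ?(lt_trans ltr01 P1)// mulrC ltW//.
    exact: truncnS_gt.
  have [p [h1 h2 h3 h4]] := scheme r P (P' P) mu (B P) L r0 P1 P'0 P'B mu0.
  exists p => _.
  have xE : v%:R / (v - 4)%:R * L%:R / ((m * M)%N%:R * log2 (P' P)) = x P * L%:R.
    by rewrite /x mulrAC.
  by rewrite xE in h1 h2 h4; split.
exists (fun P L => sval (cid (ex P L))).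
split=> [P L P1|_]; first by case: cid => p /= /(_ P1)[].
have x_gt0 P : 1 < P -> 0 < x P.
  move=> P1; have P'1 : 1 < P' P by rewrite lt_max P1.
  rewrite divr_gt0// ?divr_gt0// ?ltr0n ?subn_gt0// ?(ltn_trans _ v4)//.
  by apply: mulr_gt0; [rewrite ltr0n muln_gt0 m0|exact: log2_gt0].
split=> [P P1|].
  have xA L : x P * L%:R <= (m * M * tau P L)%N%:R.
    apply: (@le_trans _ _ (tau P L)%:R); first by rewrite ltW// truncnS_gt.
    by rewrite ler_nat leq_pmull// muln_gt0 m0.
  apply: (@squeeze_cvgr _ _ _ _ (cst 0) (fun L => (1 / 2) ^+ (m * M * tau P L))).
  - apply: nearW => L; case: cid => p /= /(_ P1)[_ _ _ ->].
    by rewrite andbT; exact: bigmax_ge_id.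
  - exact: cvg_cst.
  - exact: cvg_half_expr (x_gt0 P P1) xA.
near=> P.
have P1 : 1 < P by near: P; exact: nbhs_pinfty_gt (num_real _).
(* From [P0] on no padding remains, so the normalized time equals its limit exactly. *)
have P0P : P0 <= P by near: P; exact: nbhs_pinfty_ge (num_real _).
have lP := log2_gt0 P1.
have P'E : P' P = P by rewrite /P' max_l.
pose b : R := (m * K)%N%:R / r + (K * M)%N%:R.
rewrite (@limn_esup_ratio _ _ (b * x P) (1 + b)); last first.
  move=> L; case: cid => p /= /(_ P1)[-> -> _ _].
  rewrite /B P0P mul1n; apply: delivery_time_dist => //; first exact: ltW (x_gt0 P P1).
  by rewrite /T P'E -mulf_div divff ?mulr1// gt_eqF.
rewrite -EFinM; congr EFin; rewrite /x P'E.
exact: normalized_delivery_time.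
Unshelve. all: by end_near.
Qed.

(** All deliveries share the same constant cache, so choosing one for each channel yields a single
    policy whose caching ignores the channel. *)
Lemma achievable_soft_transfer (v : nat) : (4 < v)%N ->
  achievable_ndt M K N nu mu r (ndt_factor v)%:E.
Proof.
move=> v4.
have [q qP] := choice (fun H => channel_deliveries H v4).
pose p P L : @policy R M K N L :=
  @Policy R M K N L unit (fun _ _ _ => tt) (fun H => q H P L).
exists (fun P H => limn_esup (fun L =>
  ((fronthaul_time (q H P L) + edge_time (q H P L))%:R / L%:R)%:E)).
split=> [P P1|].
  exists (p P); split=> [L||//].
    split=> [e x|H]; first by have [+ _] := (qP 0).1 P L P1; exact.
    by have [_ /(_ H)] := (qP H).1 P L P1.
  apply: filterS ae_generic => h gh.
  exact: ((qP (mx_of_tuple h)).2 gh).1 P1.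
apply: filterS ae_generic => h gh.
by apply: cvg_near_cst; exact: ((qP (mx_of_tuple h)).2 gh).2.
Qed.

End achievability.

Theorem proposition3 (R : realType) (M K N : nat) (nu : probability R[i] R)
    (mu r : R) :
  (0 < M)%N -> (0 < K)%N -> (K <= N)%N ->
  (forall z : R[i], nu [set z] = 0%E) ->
  0 <= mu <= 1 -> 0 <= r ->
  (min_ndt M K N nu mu r <= ndt_cl_sf M K r)%E.
Proof.
move=> M0 K0 _ nu0 /andP[mu0 _] r0; rewrite /ndt_cl_sf.
(* Successors make addition of ordinals cyclic, as the schedule requires. *)
case: M K M0 K0 => [//|M] [//|K] _ _.
have [->|rn0] := eqVneq r 0; first by rewrite addey// leey.
have rp : 0 < r by rewrite lt_neqAle eq_sym rn0.
rewrite -EFinD; apply: le_excess_factor => [|v v4].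
  by rewrite addr_ge0// divr_ge0// mulr_ge0.
apply: ereal_inf_lbound; exact: achievable_soft_transfer.
Qed.
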